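(* Let $X$ be a finite set with $n=|X|\ge 4$ and let $r\in X$. Then there exists a split system $\mathcal S$ on $X$ that is rooted-injective relative to $r$ and satisfies $\dim(\mathcal S)=2$. Moreover, $\mathrm{ID}^r(n)=2$.
   Context: Let $X$ be a finite set with $|X|\ge 3$. A split of $X$ is an unordered bipartition $A|B=B|A$ of $X$ into two non-empty disjoint subsets (its parts) with $A\cup B=X$. It is trivial if one of its parts has size 1. A split system on $X$ is a set $\mathcal S$ of splits of $X$ that contains all trivial splits $\{x\}|X-\{x\}$, $x\in X$. For $S\in\mathcal S$ and $x\in X$, $S(x)$ denotes the part of $S$ containing $x$. The Buneman graph $\mathcal B(\mathcal S)$ has as vertices all maps $\phi:\mathcal S\to\mathcal P(X)$ such that (B1) $\phi(S)\in S$ for all $S\in\mathcal S$, and (B2) $\phi(S)\cap\phi(S')\ne\emptyset$ for all distinct $S,S'\in\mathcal S$. Two vertices $\phi,\phi'$ are adjacent if there is a unique $S\in\mathcal S$ with $\phi(S)\neq\phi'(S)$. For $x\in X$, $\phi_x$ denotes the vertex $S\mapsto S(x)$. It is known that $\mathcal B(\mathcal S)$ is a median graph, i.e. it is connected and any three vertices $u,v,w$ have a unique median (a vertex lying on shortest paths between each pair of $u,v,w$). For $Y=\{x,y,z\}\in\binom X3$, $\phi_Y$ denotes the median of $\phi_x,\phi_y,\phi_z$ in $\mathcal B(\mathcal S)$. For $r\in X$, a split system $\mathcal S$ on $X$ is rooted-injective relative to $r$ if $\phi_{Z\cup\{r\}}\ne\phi_{Z'\cup\{r\}}$ for all distinct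 $Z,Z'\in\binom{X-\{r\}}2$. Two distinct splits $A|B$ and $C|D$ of $X$ are incompatible if $A\cap C$, $A\cap D$, $B\cap C$, $B\cap D$ are all non-empty. A set of splits is incompatible if any two distinct splits in it are incompatible. The dimension $\dim(\mathcal S)$ is the dimension of the largest hypercube contained in $\mathcal B(\mathcal S)$ (and 1 if $\mathcal B(\mathcal S)$ is a tree); equivalently (known), it is the maximum size of an incompatible subset of $\mathcal S$. For $n=|X|\geq 3$ and $r\in X$, $\mathrm{ID}^r(n)=\min\{\dim(\mathcal S):\mathcal S\text{ is a split system on }X\text{ that is rooted-injective relative to }r\}$. *)

(* Defs.v *)
From mathcomp Require Import all_boot.
Set Implicit Arguments.
Unset Strict Implicit.
Unset Printing Implicit Defensive.

(* A walk from u of length n is recorded, as in path.v, by the n vertices that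
   follow u. *)
Definition geodesic (T : finType) (e : rel T) (u v : T) (p : seq T) : bool :=
  [&& path e u p, last u p == v &
      [forall m : 'I_(size p), forall q : m.-tuple T,
          ~~ (path e u q && (last u q == v))]].

(* A shortest path has pairwise distinct vertices, so its length is below
   #|T|: the bound on n loses nothing. *)
Definition on_geodesic (T : finType) (e : rel T) (u v w : T) : bool :=
  [exists n : 'I_#|T|, exists p : n.-tuple T,
      geodesic e u v p && (w \in u :: p)].

Definition hypercube_adj (d : nat) : rel {ffun 'I_d -> bool} :=
  fun a b => #|[set i | a i != b i]| == 1.

Definition contains_hypercube (T : finType) (e : rel T) (d : nat) : bool :=
  [exists f : {ffun {ffun 'I_d -> bool} -> T},
      injectiveb f &&
      [forall a, forall b, hypercube_adj a b ==> e (f a) (f b)]].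

(* The split A|B is encoded as the set [set A; B] of its two parts. *)
Definition is_split (X : finType) (S : {set {set X}}) : bool :=
  partition S [set: X] && (#|S| == 2).

Definition trivial_split (X : finType) (x : X) : {set {set X}} :=
  [set [set x]; [set~ x]].

Definition is_split_system (X : finType) (SS : {set {set {set X}}}) : bool :=
  [forall S in SS, is_split S] && [forall x, trivial_split x \in SS].

Definition splitSystem (X : finType) : Type :=
  {SS : {set {set {set X}}} | is_split_system SS}.

Definition splitOf (X : finType) (SS : splitSystem X) : Type :=
  {S : {set {set X}} | S \in val SS}.

Definition is_buneman_vertex (X : finType) (SS : splitSystem X)
    (phi : {ffun splitOf SS -> {set X}}) : bool :=
  [forall S, phi S \in val S] &&
  [forall S, forall S', (S != S') ==> (phi S :&: phi S' != set0)].

Definition buneman (X : finType) (SS : splitSystem X) : Type :=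
  {phi : {ffun splitOf SS -> {set X}} | is_buneman_vertex phi}.

Definition buneman_adj (X : finType) (SS : splitSystem X) : rel (buneman SS) :=
  fun phi psi => #|[set S | val phi S != val psi S]| == 1.

Lemma buneman_leaf_subproof (X : finType) (SS : splitSystem X) (x : X) :
  is_buneman_vertex [ffun S : splitOf SS => pblock (val S) x].
Proof.
have cov (S : splitOf SS) : x \in cover (val S).
  have /andP[/forall_inP/(_ _ (valP S))/andP[/cover_partition-> _] _] := valP SS.
  by rewrite inE.
apply/andP; split; apply/forallP => S; first by rewrite ffunE pblock_mem.
apply/forallP => S'; apply/implyP => _; rewrite !ffunE.
by apply/set0Pn; exists x; rewrite inE !mem_pblock !cov.
Qed.

Definition buneman_leaf (X : finType) (SS : splitSystem X) (x : X) :
    buneman SS :=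
  exist (fun phi => is_buneman_vertex phi) _ (buneman_leaf_subproof SS x).

(* The median phi_Y, meant for #|Y| = 3. [unset1] is a definite description:
   it is [Some m] when m is the only vertex lying on a shortest path between
   each pair of distinct phi_x, x in Y. As Buneman graphs are median graphs,
   [None] does not occur when #|Y| = 3. *)
Definition buneman_median (X : finType) (SS : splitSystem X) (Y : {set X}) :
    option (buneman SS) :=
  unset1 [set m : buneman SS |
    [forall x in Y, forall y in Y, (x != y) ==>
       on_geodesic (@buneman_adj X SS)
         (buneman_leaf SS x) (buneman_leaf SS y) m]].

Definition pairs_avoiding (X : finType) (r : X) : {set {set X}} :=
  [set Z : {set X} | (Z \subset [set~ r]) && (#|Z| == 2)].

Definition rooted_injective (X : finType) (r : X) (SS : splitSystem X) : bool :=
  [forall Z in pairs_avoiding r, forall Z' in pairs_avoiding r,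
     (Z != Z') ==>
     (buneman_median SS (r |: Z) != buneman_median SS (r |: Z'))].

(* A d-cube has 2 ^ d > d vertices, so bounding d by the number of vertices
   loses nothing. A Buneman graph that is a tree contains an edge (a 1-cube)
   when #|X| >= 3 and no 2-cube, so it has dimension 1. *)
Definition split_dim (X : finType) (SS : splitSystem X) : nat :=
  \max_(d < #|{: buneman SS}| | contains_hypercube (@buneman_adj X SS) d) d.

(* The minimum of [split_dim] over the rooted-injective split systems on X. The
   initial value of the fold is at least every [split_dim SS], so it does not
   affect the result as soon as some rooted-injective system exists. Up to
   bijection, X and r enter only through n = #|X|. *)
Definition rooted_injective_dim (X : finType) (r : X) : nat :=
  \big[minn/(\max_(SS : splitSystem X) split_dim SS)]_(SS : splitSystem X
    | rooted_injective r SS) split_dim SS.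

(* Main.v *)
Require Import Defs.
From mathcomp Require Import all_boot.

(* Distance in the Buneman graph is the number of splits at which two vertices
   differ, so the median of r, x, y takes at a split the part avoiding r if that
   part contains x and y, and the part containing r otherwise. So a system is
   rooted-injective iff any two pairs of points are separated by the family of
   r-free parts. Initial and final segments of a linear order on X - r do this,
   as they recover the maximum and the minimum of a pair; being a union of two
   chains, up to singletons, they contain no three pairwise incompatible splits,
   whereas a d-cube in the graph yields d of them. Conversely, separating the
   three pairs in a triple of points requires two incompatible splits, and these
   span a square. *)

Set Implicit Arguments.
Unset Strict Implicit.
Unset Printing Implicit Defensive.

(** * Splits, their parts, and incompatibility *)

Section Splits.
Variable X : finType.
Implicit Types (A B : {set X}) (S : {set {set X}}).

Lemma split_setC A : A != set0 -> ~: A != set0 -> is_split [set A; ~: A].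
Proof.
move=> A0 C0.
have neqAC : A != ~: A.
  apply: contra A0 => /eqP AC; apply/eqP.
  by rewrite -(setIid A) {2}AC setICr.
rewrite /is_split cards2 neqAC eqxx andbT /partition; apply/and3P; split.
- by rewrite /cover big_setU1 ?inE // big_set1 /= setUCr.
- apply/trivIsetP => B C; rewrite !inE => /orP[]/eqP-> /orP[]/eqP->;
    rewrite ?eqxx // => _; by rewrite -setI_eq0 ?setICr ?[~: _ :&: _]setIC ?setICr.
- by rewrite !inE negb_or eq_sym A0 eq_sym C0.
Qed.

Lemma split_eq S A : is_split S -> A \in S -> S = [set A; ~: A].
Proof.
move=> /andP[/and3P[/eqP cov /trivIsetP tI S0] /cards2P[B [C [BC eqS]]]] AS.
have CB : C = ~: B.
  have := tI B C; rewrite eqS !inE !eqxx orbT BC -setI_eq0 => /(_ isT isT isT) /eqP BC0.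
  move: cov; rewrite eqS /cover big_setU1 ?inE // big_set1 /= => cov.
  apply/setP => x; move/setP/(_ x): cov; move/setP/(_ x): BC0; rewrite !inE.
  by case: (x \in B); case: (x \in C).
move: AS; rewrite eqS !inE CB => /orP[]/eqP-> //.
by rewrite setCK setUC.
Qed.

Lemma split_part_neq0 S A : is_split S -> A \in S -> A != set0.
Proof. by move=> /andP[/and3P[_ _ S0] _]; apply: contraTneq => ->. Qed.

Lemma split_setC_mem S A : is_split S -> A \in S -> ~: A \in S.
Proof. by move=> sS AS; rewrite (split_eq sS AS) !inE eqxx orbT. Qed.

Lemma split_part2 S A B : is_split S -> A \in S -> B \in S -> B != A -> B = ~: A.
Proof.
by move=> sS AS; rewrite (split_eq sS AS) !inE => /orP[]/eqP-> //; rewrite eqxx.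
Qed.

Lemma split_mem_pblock S x : is_split S -> x \in pblock S x.
Proof. by move=> /andP[/cover_partition covS _]; rewrite mem_pblock covS inE. Qed.

Lemma split_pblock_mem S x : is_split S -> pblock S x \in S.
Proof. by move=> /andP[/cover_partition covS _]; rewrite pblock_mem ?covS ?inE. Qed.

Lemma split_pblock S A x : is_split S -> A \in S -> x \in A -> pblock S x = A.
Proof. by move=> /andP[/and3P[_ tI _] _]; apply: def_pblock. Qed.

Lemma split_pblockC S A x : is_split S -> A \in S -> x \notin A ->
  pblock S x = ~: A.
Proof. by move=> sS AS xA; apply: split_pblock; rewrite ?inE ?split_setC_mem. Qed.

(** For splits this entails distinctness, since a part never meets its complement. *)
Definition incompatible S S' : bool :=
  [forall A in S, forall B in S', A :&: B != set0].

Lemma incompatibleP S S' :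
  reflect {in S & S', forall A B, A :&: B != set0} (incompatible S S').
Proof.
apply: (iffP forall_inP) => [h A B AS BS|h A AS]; first exact: (forall_inP (h A AS)).
by apply/forall_inP => B BS; apply: h.
Qed.

Lemma incompatibleC S S' : incompatible S S' = incompatible S' S.
Proof.
by apply/incompatibleP/incompatibleP => h A B AS BS'; rewrite setIC h.
Qed.

(** Writing the mixed intersections as non-inclusions lets nested parts refute incompatibility at
    once. *)
Lemma incompatible_setC A B : incompatible [set A; ~: A] [set B; ~: B] =
  [&& A :&: B != set0, ~~ (A \subset B), ~~ (B \subset A) & ~: A :&: ~: B != set0].
Proof.
have subE (C D : {set X}) : ~~ (C \subset D) = (C :&: ~: D != set0).
  by rewrite -setDE setD_eq0.
rewrite !subE; apply/incompatibleP/and4P => [h|[h1 h2 h3 h4] C D].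
  by rewrite [B :&: _]setIC; split; apply: h; rewrite !inE eqxx ?orbT.
by rewrite !inE => /orP[]/eqP-> /orP[]/eqP->//; rewrite setIC.
Qed.

End Splits.

(** * Distances and shortest paths in the Buneman graph *)

Section BunemanGraph.
Variables (X : finType) (SS : splitSystem X).
Implicit Types (S T : splitOf SS) (u v w : buneman SS) (p : seq (buneman SS)).
Local Notation adj := (@buneman_adj X SS).

Lemma splitOfP S : is_split (val S).
Proof. by have /andP[/forall_inP/(_ _ (valP S))] := valP SS. Qed.

Lemma buneman_part u S : val u S \in val S.
Proof. by have /andP[/forallP] := valP u. Qed.

Lemma buneman_meet u S T : S != T -> val u S :&: val u T != set0.
Proof. by move=> ST; have /andP[_ /forallP/(_ S)/forallP/(_ T)/implyP] := valP u; apply. Qed.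

Lemma buneman_inj u v : (forall S, val u S = val v S) -> u = v.
Proof. by move=> uv; apply/val_inj/ffunP. Qed.

Lemma buneman_leafE x S : val (buneman_leaf SS x) S = pblock (val S) x.
Proof. by rewrite ffunE. Qed.

Lemma buneman_flip u v S : val v S != val u S -> val v S = ~: val u S.
Proof. exact: split_part2 (splitOfP S) (buneman_part u S) (buneman_part v S). Qed.

Lemma buneman_eq2 u v w S :
  val v S != val u S -> val w S != val u S -> val v S = val w S.
Proof. by move=> /buneman_flip-> /buneman_flip->. Qed.

(** Its cardinality is the distance from [u] to [v]: [diff_splits_path] gives one inequality,
    [buneman_path] the other. *)
Definition diff_splits u v : {set splitOf SS} := [set S | val u S != val v S].

Lemma buneman_adjE u v : adj u v = (#|diff_splits u v| == 1).
Proof. by []. Qed.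

Lemma diff_splits_triangle u v w :
  diff_splits u w \subset diff_splits u v :|: diff_splits v w.
Proof.
by apply/subsetP => S; rewrite !inE; apply: contraR; rewrite negb_or !negbK => /andP[/eqP->].
Qed.

Lemma diff_splits_path u p : path adj u p -> #|diff_splits u (last u p)| <= size p.
Proof.
elim: p u => [|v p IHp] u /=.
  by move=> _; rewrite leqn0 cards_eq0; apply/eqP/setP => S; rewrite !inE eqxx.
rewrite buneman_adjE => /andP[/eqP uv /IHp vp].
apply: leq_trans (subset_leq_card (diff_splits_triangle u v _)) _.
by apply: leq_trans (leq_card_setU _ _) _; rewrite uv add1n ltnS.
Qed.

(* Flipping u at a split S keeps it a vertex when u S is minimal among the parts
   of u at the splits where u and v differ. *)
Lemma buneman_step u v : u != v ->
  exists2 w, adj u w & #|diff_splits w v| < #|diff_splits u v|.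
Proof.
move=> uv; have [S0 S0P] : exists S, val u S != val v S.
  apply/existsP; apply: contraR uv; rewrite negb_exists => /forallP h.
  by apply/eqP/buneman_inj => S; apply/eqP; rewrite -[_ == _]negbK.
case: (arg_minnP (fun S => #|val u S|) (P := fun S => val u S != val v S) S0P).
move=> S SP Smin.
have wP : is_buneman_vertex [ffun T => if T == S then val v T else val u T].
  apply/andP; split; apply/forallP => T.
    by rewrite ffunE; case: ifP => _; apply: buneman_part.
  apply/forallP => T'; apply/implyP => TT'; rewrite !ffunE.
  (* (B2) is symmetric in the two splits, and inherited from [u] when neither is [S]. *)
  wlog TS : T T' TT' / T = S => [hw|].
    case: (eqVneq T S) => [TS|TS]; first by have := hw T T' TT' TS; rewrite TS eqxx.
    case: (eqVneq T' S) => [TS'|TS']; last exact: buneman_meet.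
    by have := hw T' T; rewrite eq_sym setIC TS' eqxx (negPf TS); apply; rewrite -?TS'.
  have nT'S : T' != S by rewrite -TS eq_sym.
  rewrite TS eqxx (negPf nT'S).
  case: (eqVneq (val u T') (val v T')) => [->|T'P].
    by apply: buneman_meet; rewrite eq_sym.
  have vS : val v S = ~: val u S by apply: buneman_flip; rewrite eq_sym.
  (* If the flipped part missed [val u T'], the latter would lie in [val u S]; minimality makes the
     two equal, and a part determines its split. *)
  rewrite vS setIC -setDE setD_eq0; apply/negP => sub.
  have eqT'S : val u T' = val u S by apply/eqP; rewrite eqEcard sub Smin.
  have splitT'S : val T' = val S.
    rewrite (split_eq (splitOfP T') (buneman_part u T')) eqT'S.
    by rewrite -(split_eq (splitOfP S) (buneman_part u S)).
  by case/eqP: nT'S; apply: val_inj.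
pose w : buneman SS := exist (fun phi => is_buneman_vertex phi) _ wP.
have wE T : val w T = if T == S then val v T else val u T by rewrite ffunE.
exists w.
  rewrite buneman_adjE; apply/cards1P; exists S; apply/setP => T.
  by rewrite !inE wE; case: (eqVneq T S) => [->|_]; rewrite ?eqxx.
apply: proper_card; apply/properP; split.
  by apply/subsetP => T; rewrite !inE wE; case: ifP; rewrite ?eqxx.
by exists S; rewrite inE // wE !eqxx.
Qed.

Lemma buneman_path u v :
  exists2 p, path adj u p && (last u p == v) & size p <= #|diff_splits u v|.
Proof.
have [n] := ubnP #|diff_splits u v|; elim: n u => // n IHn u.
case: (eqVneq u v) => [->|uv]; first by exists [::]; rewrite /= ?eqxx.
have [w uw wv] := buneman_step uv => ltn.
have [|p /andP[wp pv] sp] := IHn w; first exact: leq_trans wv ltn.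
by exists (w :: p); rewrite /= ?uw ?wp // (leq_ltn_trans sp).
Qed.

(** The distance formula turns minimality among all walks into a bound on the length. *)
Lemma geodesicP u v p :
  reflect [/\ path adj u p, last u p = v & size p <= #|diff_splits u v|]
          (geodesic adj u v p).
Proof.
apply: (iffP and3P) => [[up /eqP pv pmin]|[up pv sp]]; split=> //; last first.
- apply/forallP => m; apply/forallP => q; apply/negP => /andP[uq /eqP qv].
  have := diff_splits_path uq; rewrite qv size_tuple.
  by move=> /(leq_trans sp); rewrite leqNgt ltn_ord.
- exact/eqP.
have [q uqv sq] := buneman_path u v; apply: leq_trans sq.
rewrite leqNgt; apply/negP => ltqp.
by have /forallP/(_ (in_tuple q)) := forallP pmin (Ordinal ltqp); rewrite uqv.
Qed.

(** Cutting out a repetition would give a walk shorter than the distance. This keeps lengths within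
    the range that [on_geodesic] allows. *)
Lemma geodesic_uniq u v p : geodesic adj u v p -> uniq (u :: p).
Proof.
move=> /geodesicP[up <-]; case: (shortenP up) => q uq Uq qp sp.
apply: (leq_size_uniq Uq); last by rewrite ltnS (leq_trans sp) ?diff_splits_path.
by move=> x; rewrite !inE => /orP[->//|/qp->]; rewrite orbT.
Qed.

(** No split changes twice along a shortest path. Conversely, if no split changes both from [u] to
    [w] and from [w] to [v], shortest paths through [w] concatenate to a shortest path. *)
Lemma on_geodesicP u v w :
  reflect (forall S, val w S = val u S \/ val w S = val v S)
          (on_geodesic adj u v w).
Proof.
apply: (iffP existsP) => [[n /existsP[p /andP[/geodesicP[]]]]|btw].
  move=> up + + wp S; case: (splitPl wp) up => p1 p2 wE.
  rewrite cat_path last_cat wE size_cat => /andP[up1 wp2] pv sp.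
  have := diff_splits_path up1; have := diff_splits_path wp2; rewrite wE pv => s2 s1.
  (* The sizes of the two sets add up to at most the size of a subset of their union, so they are
     disjoint. *)
  have : #|diff_splits u w :&: diff_splits w v| == 0.
    rewrite -leqn0 -(leq_add2l #|diff_splits u w :|: diff_splits w v|) addn0 cardsUI.
    apply: leq_trans (leq_add s1 s2) (leq_trans sp _).
    exact: subset_leq_card (diff_splits_triangle u w v).
  rewrite cards_eq0 => /eqP/setP/(_ S); rewrite !inE.
  by case: eqP => [->|_ /=]; [left|case: eqP => // ->; right].
have [p /andP[up /eqP pw] sp] := buneman_path u w.
have [q /andP[wq /eqP qv] sq] := buneman_path w v.
have disj : [disjoint diff_splits u w & diff_splits w v].
  rewrite -setI_eq0; apply/eqP/setP => S; rewrite !inE.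
  by case: (btw S) => ->; rewrite eqxx ?andbF.
have geo : geodesic adj u v (p ++ q).
  apply/geodesicP; rewrite cat_path last_cat pw up qv; split=> //.
  rewrite size_cat; apply: leq_trans (leq_add sp sq) _.
  rewrite -cardsUI (disjoint_setI0 disj) cards0 addn0.
  apply/subset_leq_card/subsetP => S; rewrite !inE.
  by case: (btw S) => ->; rewrite eqxx ?orbF.
have ltpq : size (p ++ q) < #|{: buneman SS}|.
  by have := geodesic_uniq geo => /card_uniqP /= <-; apply: max_card.
exists (Ordinal ltpq); apply/existsP; exists (in_tuple (p ++ q)).
by rewrite geo inE mem_cat -pw; case: (p) => [|x p'] /=; rewrite ?eqxx // mem_last orbT.
Qed.

(** * Medians of the root and a pair *)

Definition root_median_fun r (Z : {set X}) : {ffun splitOf SS -> {set X}} :=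
  [ffun S => if Z \subset ~: pblock (val S) r then ~: pblock (val S) r
             else pblock (val S) r].

(** For (B2): each chosen part contains either all of [Z], or [r] together with some point of [Z].
    Any two such parts share [r] or a point of [Z]. *)
Lemma root_median_subproof r Z : Z != set0 -> is_buneman_vertex (root_median_fun r Z).
Proof.
move=> /set0Pn[z zZ]; apply/andP; split; apply/forallP => S.
  have Sr := split_pblock_mem r (splitOfP S).
  by rewrite ffunE; case: ifP => // _; apply: split_setC_mem (splitOfP S) Sr.
have part T : (Z \subset root_median_fun r Z T) ||
    [exists x in Z, (x \in root_median_fun r Z T) && (r \in root_median_fun r Z T)].
  rewrite ffunE; case: ifP => [->//|/negbT/subsetPn[x xZ]].
  rewrite inE negbK => xr; apply/orP; right; apply/exists_inP; exists x => //.
  by rewrite xr split_mem_pblock ?splitOfP.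
apply/forallP => T; apply/implyP => _; apply/set0Pn.
have [/orP[ZS|/exists_inP[x xZ /andP[xS rS]]]] := part S;
  have [/orP[ZT|/exists_inP[y yZ /andP[yT rT]]]] := part T.
- by exists z; rewrite inE (subsetP ZS) // (subsetP ZT).
- by exists y; rewrite inE (subsetP ZS) // yT.
- by exists x; rewrite inE xS (subsetP ZT).
- by exists r; rewrite inE rS rT.
Qed.

Definition root_median r Z (Z0 : Z != set0) : buneman SS :=
  exist (fun phi => is_buneman_vertex phi) _ (root_median_subproof r Z0).

Lemma root_medianE r Z (Z0 : Z != set0) S :
  val (root_median r Z0) S =
    if Z \subset ~: pblock (val S) r then ~: pblock (val S) r else pblock (val S) r.
Proof. by rewrite ffunE. Qed.

(** Lying between each two of the three leaves means taking their majority value at every split, and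
    three choices between two parts have exactly one majority. *)
Lemma buneman_median_root r Z (Z0 : Z != set0) : Z \in pairs_avoiding r ->
  buneman_median SS (r |: Z) = Some (root_median r Z0).
Proof.
rewrite inE => /andP[Zr /cards2P[x [y [xy eqZ]]]].
rewrite /buneman_median -[RHS]set1K; congr unset1; apply/setP => m; rewrite !inE.
have rx : r != x.
  by rewrite eq_sym; have := subsetP Zr x; rewrite eqZ !inE eqxx => /(_ isT).
have ry : r != y.
  by rewrite eq_sym; have := subsetP Zr y; rewrite eqZ !inE eqxx orbT => /(_ isT).
have rE (S : splitOf SS) := split_mem_pblock r (splitOfP S).
have rS (S : splitOf SS) := split_pblock_mem r (splitOfP S).
have leafE z (S : splitOf SS) : val (buneman_leaf SS z) S =
    if z \in pblock (val S) r then pblock (val S) r else ~: pblock (val S) r.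
  rewrite buneman_leafE; case: ifP => [|/negbT]; first exact: split_pblock (splitOfP S) (rS S).
  exact: split_pblockC (splitOfP S) (rS S).
have Zsub (S : splitOf SS) : (Z \subset ~: pblock (val S) r) =
    (x \notin pblock (val S) r) && (y \notin pblock (val S) r).
  by rewrite eqZ subUset !sub1set !inE.
apply/idP/eqP => [h|->].
  have btw a b : a \in r |: Z -> b \in r |: Z -> a != b -> forall S,
     val m S = val (buneman_leaf SS a) S \/ val m S = val (buneman_leaf SS b) S.
    move=> aY bY ab; apply/on_geodesicP.
    by have /forall_inP/(_ _ bY)/implyP/(_ ab) := forall_inP h _ aY.
  apply: buneman_inj => S; rewrite root_medianE Zsub.
  have := btw r x; have := btw r y; have := btw x y.
  rewrite eqZ !inE !eqxx !orbT /= => /(_ isT isT xy S) + /(_ isT isT ry S) + /(_ isT isT rx S).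
  rewrite !leafE rE; case: (x \in _); case: (y \in _) => /=; try by [case].
  - by move=> _ _ [].
  - by move=> _ [].
apply/forall_inP => a aY; apply/forall_inP => b bY; apply/implyP => ab.
apply/on_geodesicP => S; rewrite root_medianE Zsub !leafE.
move: aY bY ab; rewrite eqZ !inE => /or3P[]/eqP-> /or3P[]/eqP->; rewrite ?eqxx //= => _;
  rewrite ?rE; case: (x \in _); case: (y \in _) => /=; by [left|right].
Qed.

(** At each split the median records just whether the pair lies in the [r]-free part; the two
    possible values differ because only one contains [r]. *)
Lemma rooted_injectiveP r :
  reflect ({in pairs_avoiding r &, forall Z Z' : {set X},
              (forall S, (Z \subset ~: pblock (val S) r)
                         = (Z' \subset ~: pblock (val S) r)) -> Z = Z'})
          (rooted_injective r SS).
Proof.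
have neq0 Z : Z \in pairs_avoiding r -> Z != set0.
  by rewrite inE => /andP[_ /eqP cZ]; rewrite -cards_eq0 cZ.
apply: (iffP forall_inP) => [h Z Z' rZ rZ' sameS|h Z rZ].
  apply/eqP/negPn/negP => ZZ'.
  have /forall_inP/(_ _ rZ')/implyP/(_ ZZ') := h _ rZ.
  rewrite (buneman_median_root (neq0 _ rZ)) // (buneman_median_root (neq0 _ rZ')) //.
  by case/eqP; congr Some; apply: buneman_inj => S; rewrite !root_medianE sameS.
apply/forall_inP => Z' rZ'; apply/implyP; apply: contra => /eqP eqm; apply/eqP/h => // S.
move: eqm; rewrite (buneman_median_root (neq0 _ rZ)) // (buneman_median_root (neq0 _ rZ')) //.
move=> [/ffunP/(_ S)]; rewrite !ffunE.
have := split_mem_pblock r (splitOfP S).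
by case: ifP; case: ifP => // _ _ rS /setP/(_ r); rewrite inE rS.
Qed.

(** * Hypercubes and incompatible splits *)

(* The values of the four vertices of a 4-cycle at the two splits that it
   changes are all four pairs of parts, which meet by (B2). *)
Lemma square_incompatible u v t w : adj u v -> adj u t -> adj v w -> adj t w ->
  v != t -> u != w ->
  forall S T, val u S != val v S -> val u T != val t T -> incompatible (val S) (val T).
Proof.
rewrite !buneman_adjE => /cards1P[S' uv] /cards1P[T' ut] /cards1P[L vw] /cards1P[M tw].
move=> vt uw S T uvS utT.
have eS : S = S' by apply/set1P; rewrite -uv inE.
have eT : T = T' by apply/set1P; rewrite -ut inE.
move: uv ut; rewrite -{}eS -{}eT => /setP uv /setP ut {S' T'}.
move/setP: vw => vw; move/setP: tw => tw.
have uvE R : R != S -> val u R = val v R.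
  by have := uv R; rewrite !inE => <- /negPn/eqP.
have utE R : R != T -> val u R = val t R.
  by have := ut R; rewrite !inE => <- /negPn/eqP.
have vwE R : R != L -> val v R = val w R.
  by have := vw R; rewrite !inE => <- /negPn/eqP.
have twE R : R != M -> val t R = val w R.
  by have := tw R; rewrite !inE => <- /negPn/eqP.
(* If both edges at [u] changed the same split, [v] and [t] would coincide. *)
have ST : S != T.
  apply: contra vt => /eqP ST; apply/eqP/buneman_inj => R.
  case: (eqVneq R S) => [->|RS]; last by rewrite -uvE // utE // -ST.
  by apply: (buneman_eq2 (u := u)); rewrite eq_sym // ST.
(* Changing [S] a second time would lead back to [u]. *)
have LS : L != S.
  apply: contra uw => /eqP LS; apply/eqP/buneman_inj => R.
  case: (eqVneq R S) => [->|RS]; last by rewrite uvE // vwE // LS.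
  apply: (buneman_eq2 (u := v)) => //; rewrite eq_sym.
  by have := vw S; rewrite !inE LS eqxx.
have MT : M != T.
  apply: contra uw => /eqP MT; apply/eqP/buneman_inj => R.
  case: (eqVneq R T) => [->|RT]; last by rewrite utE // twE // MT.
  apply: (buneman_eq2 (u := t)) => //; rewrite eq_sym.
  by have := tw T; rewrite !inE MT eqxx.
have TS : T != S by rewrite eq_sym.
have vS : val v S = ~: val u S by apply: buneman_flip; rewrite eq_sym.
have tT : val t T = ~: val u T by apply: buneman_flip; rewrite eq_sym.
have wS : val w S = ~: val u S by rewrite -vwE // eq_sym.
have wT : val w T = ~: val u T by rewrite -twE // eq_sym.
rewrite (split_eq (splitOfP S) (buneman_part u S)).
rewrite (split_eq (splitOfP T) (buneman_part u T)).
have := buneman_meet u ST; have := buneman_meet v ST; have := buneman_meet t ST.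
have := buneman_meet w ST.
rewrite wS wT vS tT -utE // -uvE // => m1 m2 m3 m4.
by apply/incompatibleP => A B; rewrite !inE => /orP[]/eqP-> /orP[]/eqP->.
Qed.

(** The splits are those changed by the [d] edges at the image of the zero vector; any two of these
    edges lie on a square of the cube. *)
Lemma hypercube_incompatible d : contains_hypercube adj d ->
  exists s : 'I_d -> splitOf SS,
    forall i j, i != j -> incompatible (val (s i)) (val (s j)).
Proof.
move=> /existsP[f /andP[/injectiveP injf /forallP homf]].
pose a0 : {ffun 'I_d -> bool} := [ffun=> false].
pose a1 i : {ffun 'I_d -> bool} := [ffun k => k == i].
pose a2 i j : {ffun 'I_d -> bool} := [ffun k => (k == i) || (k == j)].
have hom (a b : {ffun 'I_d -> bool}) i : (forall k, (a k != b k) = (k == i)) ->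
    adj (f a) (f b).
  move=> ab; have /forallP/(_ b)/implyP := homf a; apply.
  by apply/cards1P; exists i; apply/setP => k; rewrite !inE ab.
have adj01 i : adj (f a0) (f (a1 i)).
  by apply: (hom _ _ i) => k; rewrite !ffunE; case: (k == i).
have neq_ffun (a b : {ffun 'I_d -> bool}) i : a i != b i -> f a != f b.
  by move=> abi; apply: contra abi => /eqP/injf->.
have [s sP] : exists s : 'I_d -> splitOf SS,
    forall i, val (f a0) (s i) != val (f (a1 i)) (s i).
  apply: (fin_all_exists (P := fun i S => val (f a0) S != val (f (a1 i)) S)) => i.
  have /cards1P[S eqS] := adj01 i; exists S.
  by move/setP/(_ S): eqS; rewrite !inE eqxx.
exists s => i j ij.
apply: (square_incompatible (adj01 i) (adj01 j) (w := f (a2 i j))) => //.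
- apply: (hom _ _ j) => k; rewrite !ffunE.
  by case: (eqVneq k i) => [->|_]; rewrite ?(negPf ij) //=; case: (k == j).
- apply: (hom _ _ i) => k; rewrite !ffunE.
  by case: (eqVneq k j) => [->|_]; rewrite ?orbT ?orbF 1?eq_sym ?(negPf ij) //; case: (k == i).
- by apply: (neq_ffun _ _ i); rewrite !ffunE eqxx (negPf ij).
- by apply: (neq_ffun _ _ i); rewrite !ffunE eqxx.
Qed.

Lemma split_dim_le2 :
  (forall S1 S2 S3, incompatible (val S1) (val S2) -> incompatible (val S1) (val S3) ->
     incompatible (val S2) (val S3) -> False) ->
  split_dim SS <= 2.
Proof.
move=> no_triple; apply/bigmax_leqP => -[d ltd] /= /hypercube_incompatible[s sP].
rewrite leqNgt; apply/negP => gt2.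
pose s' k (ltk : k < 3) := s (Ordinal (leq_trans ltk gt2)).
by apply: (no_triple (s' 0 isT) (s' 1 isT) (s' 2 isT)); apply: sP.
Qed.

(* A part lying inside a part of S or T must be avoided by a vertex of the
   square; every other split takes the part containing a fixed point r. *)
Lemma incompatible_square S T : incompatible (val S) (val T) -> 2 <= split_dim SS.
Proof.
move=> ST; have /incompatibleP meetST := ST.
have [sS sT] := (splitOfP S, splitOfP T).
have [A AS] : exists A, A \in val S.
  by apply/set0Pn; rewrite -card_gt0; have /andP[_ /eqP->] := sS.
have /set0Pn[r _] := split_part_neq0 sS AS.
(* A part that is not small meets every part of [S] and of [T]. *)
pose small (P : {set X}) := [exists Q in val S :|: val T, P \subset Q].
have smallP (P Q : {set X}) : Q \in val S :|: val T -> P \subset Q -> small P.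
  by move=> QST PQ; apply/exists_inP; exists Q.
have setC_ST (Q : {set X}) : Q \in val S :|: val T -> ~: Q \in val S :|: val T.
  by rewrite !inE => /orP[]/split_setC_mem->; rewrite ?orbT.
have neqST : S != T.
  apply/negP => /eqP eqST; have Sr := split_pblock_mem r sS.
  have := meetST _ _ Sr (_ : ~: pblock (val S) r \in val T).
  by rewrite -eqST split_setC_mem // setICr eqxx => /(_ isT).
have same_split (R R' : splitOf SS) (P : {set X}) : P \in val R -> P \in val R' -> R = R'.
  move=> PR PR'; apply: val_inj.
  by rewrite (split_eq (splitOfP R) PR) -(split_eq (splitOfP R') PR').
(* If [P] and its complement lay in [Q] and [Q'], then [~: Q] and [~: Q'] would be disjoint. This
   contradicts incompatibility when [Q] and [Q'] come from different splits; when they come from the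
   same one, it forces [P = Q], so [R] is [S] or [T]. *)
have big_setC (R : splitOf SS) (P : {set X}) : R != S -> R != T -> P \in val R ->
    small P -> ~~ small (~: P).
  move=> RS RT PR /exists_inP[Q QST PQ]; apply/exists_inP => -[Q' QST' PQ'].
  have cover_QQ' : ~: Q :&: ~: Q' = set0.
    apply/setP => x; have := subsetP PQ x; have := subsetP PQ' x; rewrite !inE.
    by case: (x \in P) => [_ /(_ isT)->|/(_ isT)->]; rewrite ?andbF.
  have same (R' : splitOf SS) : R != R' -> Q \in val R' -> Q' \in val R' -> False.
    move=> RR' QR' QR''; case: (eqVneq Q' Q) => [eqQ|neqQ].
      move: cover_QQ'; rewrite eqQ setIid => /eqP; apply/negP.
      exact: split_part_neq0 (splitOfP R') (split_setC_mem (splitOfP R') QR').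
    have QE := split_part2 (splitOfP R') QR' QR'' neqQ.
    case/eqP: RR'; apply: (same_split _ _ P) => //.
    suff -> : P = Q by [].
    by apply/eqP; rewrite eqEsubset PQ -setCS -QE.
  move: QST QST'; rewrite !inE => /orP[]Q1 /orP[]Q1'.
  - exact: same Q1 Q1'.
  - by have := meetST _ _ (split_setC_mem sS Q1) (split_setC_mem sT Q1');
      rewrite cover_QQ' eqxx.
  - by have := meetST _ _ (split_setC_mem sS Q1') (split_setC_mem sT Q1);
      rewrite setIC cover_QQ' eqxx.
  - exact: same Q1 Q1'.
pose side (R : splitOf SS) (b : bool) := if b then pblock (val R) r else ~: pblock (val R) r.
have side_mem R b : side R b \in val R.
  have Rr := split_pblock_mem r (splitOfP R).
  by case: b => //; apply: split_setC_mem (splitOfP R) Rr.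
have side_inj R : injective (side R).
  have rR := split_mem_pblock r (splitOfP R).
  by move=> [] [] //= /setP/(_ r); rewrite inE rR.
pose rest (R : splitOf SS) := ~~ small (pblock (val R) r).
have rest_big R : R != S -> R != T -> ~~ small (side R (rest R)).
  rewrite /rest => RS RT; case: (boolP (small (pblock (val R) r))) => //=.
  exact: big_setC (side_mem R true).
have small_meet R R' : R' != S -> R' != T -> small (pblock (val R) r) ->
    side R (rest R) :&: side R' (rest R') != set0.
  (* A value at [R'] disjoint from the value at [R] would lie in the small part of [R], hence be
     small itself. *)
  move=> RS' RT' sR; apply: contra (rest_big _ RS' RT'); rewrite /rest sR /=.
  rewrite setIC setI_eq0 disjoints_subset setCK => sub.
  by case/exists_inP: sR => Q QST QP; apply: (smallP _ Q) (subset_trans sub QP).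
have rest_meet R R' : R != S -> R != T -> R' != S -> R' != T ->
    side R (rest R) :&: side R' (rest R') != set0.
  move=> RS RT RS' RT'.
  case: (boolP (small (pblock (val R) r))) => [|sR]; first exact: small_meet.
  case: (boolP (small (pblock (val R') r))) => [|sR'].
    by rewrite setIC; apply: small_meet.
  by apply/set0Pn; exists r; rewrite /rest sR sR' inE !split_mem_pblock ?splitOfP.
(* The four corners of the square: free choices at [S] and [T], a common value at all other
   splits. *)
pose u (a b : bool) : {ffun splitOf SS -> {set X}} :=
  [ffun R => side R (if R == S then a else if R == T then b else rest R)].
have uP a b : is_buneman_vertex (u a b).
  apply/andP; split; apply/forallP => R; first by rewrite ffunE side_mem.
  apply/forallP => R'; apply/implyP => RR'; rewrite !ffunE.
  have meet_big (P Q : {set X}) : ~~ small P -> Q \in val S :|: val T -> P :&: Q != set0.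
    move=> bigP QST; apply: contra bigP; rewrite setI_eq0 disjoints_subset.
    exact/smallP/setC_ST.
  have memS c : side S c \in val S :|: val T by rewrite inE side_mem.
  have memT c : side T c \in val S :|: val T by rewrite inE side_mem orbT.
  case: (eqVneq R S) RR' => [->|RS]; case: (eqVneq R' S) => [->|RS'];
    rewrite ?eqxx //=; last first.
  - case: (eqVneq R T) => [->|RT]; case: (eqVneq R' T) => [->|RT']; rewrite ?eqxx //= => RR'.
    + by rewrite setIC meet_big ?rest_big.
    + by rewrite meet_big ?rest_big.
    + exact: rest_meet.
  - case: (eqVneq R T) => [->|RT] RR'; last by rewrite meet_big ?rest_big.
    by rewrite setIC meetST ?side_mem.
  - case: (eqVneq R' T) => [->|RT] RR'; first by rewrite meetST ?side_mem.
    by rewrite setIC meet_big ?rest_big.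
pose v a b : buneman SS := exist (fun phi => is_buneman_vertex phi) _ (uP a b).
have vE a b R : val (v a b) R =
  side R (if R == S then a else if R == T then b else rest R) by rewrite ffunE.
have TS : (T == S) = false by apply/negbTE; rewrite eq_sym.
pose f := [ffun a : {ffun 'I_2 -> bool} => v (a ord0) (a ord_max)].
have fE a : f a = v (a ord0) (a ord_max) by rewrite ffunE.
have ord2P (i : 'I_2) : i = ord0 \/ i = ord_max.
  by case: i => [[|[|]] lti] //; [left|right]; apply: val_inj.
have injf : injective f.
  move=> a b; rewrite !ffunE => ab; apply/ffunP => i.
  have := congr1 (fun w : buneman SS => val w S) ab.
  have := congr1 (fun w : buneman SS => val w T) ab.
  rewrite !vE TS !eqxx => /side_inj abT /side_inj abS.
  by case: (ord2P i) => ->.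
(* [split_dim] only ranges over dimensions below the number of vertices; the square provides
   four. *)
have lt2 : 2 < #|{: buneman SS}|.
  by apply: leq_trans (leq_card f injf); rewrite card_ffun card_bool card_ord.
apply: (bigmax_sup (Ordinal lt2)) => //.
apply/existsP; exists f; apply/andP; split; first exact/injectiveP.
apply/forallP => a; apply/forallP => b; apply/implyP => /cards1P[i /setP ab].
apply/cards1P; exists (if i == ord0 then S else T); apply/setP => R.
have := ab ord0; have := ab ord_max; rewrite !inE !fE !vE (inj_eq (@side_inj R)).
case: (ord2P i) => -> /= ab1 ab0.
- case: (eqVneq R S) => [_|RS]; first by rewrite ab0.
  by case: (eqVneq R T); rewrite ?ab1 ?eqxx.
- case: (eqVneq R S) => [->|RS]; first by rewrite ab0 (negPf neqST).
  by case: (eqVneq R T); rewrite ?ab1 ?eqxx.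
Qed.

End BunemanGraph.

(** * Rooted-injectivity forces dimension at least 2 *)

Section LowerBound.
Variables (X : finType) (r : X).
Implicit Types (S T : {set {set X}}).

(** The points [r], [a], [b], [c] witness the four intersections. *)
Lemma overlap_incompatible S T a b c : is_split S -> is_split T ->
  a \notin pblock S r -> a \notin pblock T r ->
  b \notin pblock S r -> b \in pblock T r ->
  c \in pblock S r -> c \notin pblock T r -> incompatible S T.
Proof.
move=> sS sT aS aT bS bT cS cT.
rewrite (split_eq sS (split_pblock_mem r sS)) (split_eq sT (split_pblock_mem r sT)).
rewrite incompatible_setC; apply/and4P; split.
- by apply/set0Pn; exists r; rewrite inE !split_mem_pblock.
- by apply/subsetPn; exists c.
- by apply/subsetPn; exists b.
- by apply/set0Pn; exists a; rewrite !inE aS.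
Qed.

(* Among the pairs xy, xz, yz some r-free part contains exactly one; the other
   two pairs are separated by a second r-free part, which overlaps the first. *)
Lemma rooted_injective_dim_ge2 (SS : splitSystem X) : 4 <= #|X| ->
  rooted_injective r SS -> 2 <= split_dim SS.
Proof.
move=> hX /rooted_injectiveP inj.
have /card_gt2P[x [y [z [[]]]]] : 2 < #|[set~ r]|.
  by rewrite cardsC1 -ltnS prednK // (leq_trans _ hX).
rewrite !inE => xr yr zr [xy yz zx].
pose c (S : splitOf SS) a := a \notin pblock (val S) r.
(* Injectivity applied to the pairs [ab] and [ab']: an [r]-free part containing only one of them
   contains [a] and exactly one of [b], [b']. *)
have sep a b b' : a != r -> b != r -> b' != r -> a != b -> a != b' -> b != b' ->
    exists S : splitOf SS, c S a /\ c S b != c S b'.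
  move=> ar br b'r ab ab' bb'.
  have pairP d : d != r -> a != d -> [set a; d] \in pairs_avoiding r.
    by move=> dr ad; rewrite inE subUset !sub1set !inE ar dr cards2 ad.
  have : [set a; b] != [set a; b'].
    apply/eqP => /setP/(_ b); rewrite !inE eqxx orbT (negPf bb') orbF.
    by rewrite eq_sym (negPf ab).
  case: (pickP (fun S : splitOf SS => c S a && (c S b != c S b'))) => [S /andP[]|none].
    by exists S.
  move=> /eqP[]; apply: inj; rewrite ?pairP // => S.
  rewrite !subUset !sub1set !inE; have := none S; rewrite /c.
  by case: (a \in _) => //= /negbFE/eqP->.
have overlap (S T : splitOf SS) d e f : c S d -> c T d -> c S e -> ~~ c T e ->
    ~~ c S f -> c T f -> 2 <= split_dim SS.
  move=> Sd Td Se /negPn Te /negPn Sf Tf; apply: (@incompatible_square _ _ S T).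
  by apply: (overlap_incompatible (a := d) (b := e) (c := f)) => //; apply: splitOfP.
have [zy xz yx] : [/\ z != y, x != z & y != x] by split; rewrite eq_sym.
have [S1 [S1x S1yz]] := sep x y z xr yr zr xy xz yz.
have [S2 [S2y S2xz]] := sep y x z yr xr zr yx yz xz.
have [S3 [S3z S3xy]] := sep z x y zr xr yr zx zy xy.
(* The [r]-free part of [S1] contains [x] and one of [y], [z]. The point left out selects [S3] or
   [S2], whose [r]-free part contains that point and exactly one of the other two, so it overlaps
   that of [S1]. *)
case S1y: (c S1 y) S1yz => S1z.
  case S3x: (c S3 x) S3xy => S3y.
    exact: (overlap S1 S3 x y z).
  by apply: (overlap S1 S3 y x z) => //; rewrite ?S3x //; move: S3y; case: (c S3 y).
have {}S1z : c S1 z by move: S1z; case: (c S1 z).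
case S2x: (c S2 x) S2xz => S2z.
  by apply: (overlap S1 S2 x z y) => //; rewrite ?S1y.
by apply: (overlap S1 S2 z x y) => //; rewrite ?S1y ?S2x //; move: S2z; case: (c S2 z).
Qed.

End LowerBound.

(** * The system of initial and final segments *)

Section SegmentSystem.
Variables (X : finType) (r : X).
Implicit Types (S T : {set {set X}}).

(** The linear order on X - r is the one given by [enum_rank]. *)
Definition initial_segment (y : X) : {set X} :=
  [set x | (x != r) && (enum_rank x <= enum_rank y)].

Definition final_segment (y : X) : {set X} :=
  [set x | (x != r) && (enum_rank y <= enum_rank x)].

Definition segment_splits (segment : X -> {set X}) : {set {set {set X}}} :=
  [set [set segment y; ~: segment y] | y in [set~ r]].

Definition segment_system : {set {set {set X}}} :=
  [set trivial_split x | x : X]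
  :|: (segment_splits initial_segment :|: segment_splits final_segment).

Lemma segment_system_split : 1 < #|X| -> is_split_system segment_system.
Proof.
move=> X1; apply/andP; split; last by apply/forallP => x; rewrite !inE imset_f.
have segP (segment : X -> {set X}) S : (forall y, y != r -> y \in segment y) ->
    (forall y, r \notin segment y) -> S \in segment_splits segment -> is_split S.
  move=> seg_id seg_r /imsetP[y]; rewrite !inE => yr ->.
  by apply: split_setC; apply/set0Pn; [exists y; apply: seg_id | exists r; rewrite inE seg_r].
apply/forall_inP => S; rewrite !inE => /or3P[/imsetP[x _ ->]||].
- apply: split_setC; first by apply/set0Pn; exists x; rewrite inE.
  by rewrite -card_gt0 cardsC1 -subn1 subn_gt0.
- by apply: segP => y; rewrite inE ?eqxx // => ->; rewrite leqnn.
- by apply: segP => y; rewrite inE ?eqxx // => ->; rewrite leqnn.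
Qed.

(** The singleton of [x] is included in the part of [T] that contains [x]. *)
Lemma trivial_compatible x T : is_split T -> ~~ incompatible (trivial_split x) T.
Proof.
move=> sT; rewrite (split_eq sT (split_pblock_mem x sT)) incompatible_setC.
by rewrite sub1set split_mem_pblock ?andbF.
Qed.

Lemma chain_compatible (segment : X -> {set X}) S T :
  (forall y z, segment y \subset segment z \/ segment z \subset segment y) ->
  S \in segment_splits segment -> T \in segment_splits segment -> ~~ incompatible S T.
Proof.
move=> chain /imsetP[y _ ->] /imsetP[z _ ->]; rewrite incompatible_setC.
by case: (chain y z) => ->; rewrite ?andbF.
Qed.

(** A split incompatible with another is not trivial, so all three come from two chains; two of them
    share a chain and are compatible. *)
Lemma segment_system_no_triple S1 S2 S3 : 1 < #|X| ->
  S1 \in segment_system -> S2 \in segment_system -> S3 \in segment_system ->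
  incompatible S1 S2 -> incompatible S1 S3 -> incompatible S2 S3 -> False.
Proof.
move=> X1 S1S S2S S3S inc12 inc13 inc23.
have /andP[/forall_inP splitS _] := segment_system_split X1.
have nontrivial S T : S \in segment_system -> T \in segment_system -> incompatible S T ->
    S \in segment_splits initial_segment \/ S \in segment_splits final_segment.
  move=> SS /splitS sT; move: SS.
  rewrite !inE => /or3P[/imsetP[x _ ->]||]; [|by left|by right].
  by rewrite (negPf (trivial_compatible x sT)).
have initial_chain S T := @chain_compatible initial_segment S T.
have final_chain S T := @chain_compatible final_segment S T.
have {}initial_chain S T : S \in segment_splits initial_segment ->
    T \in segment_splits initial_segment -> incompatible S T -> False.
  move=> Sc Tc; apply/negP; apply: initial_chain Sc Tc => y z.
  by case/orP: (leq_total (enum_rank y) (enum_rank z)) => le; [left|right];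
    apply/subsetP => x; rewrite !inE => /andP[->] /leq_trans->.
have {}final_chain S T : S \in segment_splits final_segment ->
    T \in segment_splits final_segment -> incompatible S T -> False.
  move=> Sc Tc; apply/negP; apply: final_chain Sc Tc => y z.
  by case/orP: (leq_total (enum_rank y) (enum_rank z)) => le; [right|left];
    apply/subsetP => x; rewrite !inE => /andP[->]; apply: leq_trans.
have S1c := nontrivial S1 S2 S1S S2S inc12.
have S2c := nontrivial S2 S3 S2S S3S inc23.
have S3c : S3 \in segment_splits initial_segment \/ S3 \in segment_splits final_segment.
  by apply: (nontrivial S3 S1) => //; rewrite incompatibleC.
have [nI nF] := (initial_chain, final_chain).
case: S1c => S1c; case: S2c => S2c; case: S3c => S3c;
  by [apply: nI inc12|apply: nI inc13|apply: nI inc23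
     |apply: nF inc12|apply: nF inc13|apply: nF inc23].
Qed.

Lemma pairs_avoiding_rank (Z : {set X}) : Z \in pairs_avoiding r ->
  exists x y, [/\ Z = [set x; y], x != r, y != r & enum_rank x < enum_rank y].
Proof.
rewrite inE => /andP[Zr /cards2P[x [y [xy eqZ]]]].
move: Zr; rewrite eqZ subUset !sub1set !inE => /andP[xr yr].
case: (ltngtP (enum_rank x) (enum_rank y)) => [lt|lt|/val_inj/enum_rank_inj eqxy].
- by exists x, y.
- by exists y, x; rewrite setUC.
- by rewrite eqxy eqxx in xy.
Qed.

(* The smallest initial (final) segment containing a pair ends (starts) at its
   maximum (minimum). *)
Lemma segment_system_injective (SS : splitSystem X) :
  val SS = segment_system -> rooted_injective r SS.
Proof.
move=> eqSS; apply/rooted_injectiveP => Z Z' /pairs_avoiding_rank[x [y [-> xr yr xy]]].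
move=> /pairs_avoiding_rank[x' [y' [-> x'r y'r xy']]] same.
(* When [A] avoids [r], the [r]-free part of its split is [A] itself. *)
have seg (A : {set X}) : r \notin A -> [set A; ~: A] \in segment_system ->
    ([set x; y] \subset A) = ([set x'; y'] \subset A).
  move=> rA; rewrite -eqSS => AS.
  have := same (exist (fun S => S \in val SS) _ AS) => /=.
  rewrite (_ : pblock _ r = ~: A) ?setCK //.
  apply: (split_pblockC (splitOfP (exist (fun S => S \in val SS) _ AS))) => //=.
  by rewrite !inE eqxx.
have initial z : z != r -> ([set x; y] \subset initial_segment z)
    = ([set x'; y'] \subset initial_segment z).
  by move=> zr; apply: seg;
    rewrite ?inE ?eqxx // (imset_f _ (_ : z \in [set~ r])) ?inE // orbT.
have final z : z != r -> ([set x; y] \subset final_segment z)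
    = ([set x'; y'] \subset final_segment z).
  by move=> zr; apply: seg;
    rewrite ?inE ?eqxx // orbA orbC (imset_f _ (_ : z \in [set~ r])) ?inE.
have [xlt ylt] := (ltnW xy, ltnW xy').
have eq_rank a b : enum_rank a <= enum_rank b -> enum_rank b <= enum_rank a -> a = b.
  by move=> ab ba; apply/enum_rank_inj/val_inj/anti_leq/andP.
(* The initial segments ending at [y] and at [y'] bound each maximum by the other. *)
have -> : y = y'.
  have := initial y yr; have := initial y' y'r.
  rewrite !subUset !sub1set !inE xr yr x'r y'r /= !leqnn xlt ylt /=.
  by move=> /andP[_ yy'] /esym/andP[_ y'y]; apply: eq_rank.
have -> // : x = x'.
have := final x xr; have := final x' x'r.
rewrite !subUset !sub1set !inE xr yr x'r y'r /= !leqnn xlt ylt /=.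
by move=> /andP[xx' _] /esym/andP[x'x _]; apply: eq_rank.
Qed.

End SegmentSystem.

(** * The minimum dimension *)

(** The initial value [n] is arbitrary: the fold drops to at most [F j] once [j] is met, and later
    steps only decrease it. *)
Lemma bigminn_le (I : finType) (P : pred I) n (F : I -> nat) j :
  P j -> \big[minn/n]_(i | P i) F i <= F j.
Proof.
move=> Pj; elim: (index_enum I) (mem_index_enum j) => // i s IHs.
rewrite inE big_cons => /predU1P[<-|/IHs le_s]; first by rewrite Pj geq_minl.
by case: ifP => // _; apply: leq_trans (geq_minr _ _) le_s.
Qed.

Theorem theorem5 (X : finType) (r : X) (hX : 4 <= #|X|) :
  (exists SS : splitSystem X, rooted_injective r SS /\ split_dim SS = 2)
  /\ rooted_injective_dim r = 2.
Proof.
have X1 : 1 < #|X| by apply: leq_trans hX.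
pose SS : splitSystem X := exist (fun SS => is_split_system SS) _ (segment_system_split r X1).
have injSS : rooted_injective r SS by apply: segment_system_injective.
have dimSS : split_dim SS = 2.
  apply/eqP; rewrite eqn_leq (rooted_injective_dim_ge2 hX injSS) andbT.
  by apply: split_dim_le2 => S1 S2 S3;
    apply: (segment_system_no_triple X1) (valP _) (valP _) (valP _).
split; first by exists SS.
apply/eqP; rewrite eqn_leq; apply/andP; split.
  by rewrite -[X in _ <= X]dimSS; apply: bigminn_le.
(* The lower bound must also hold for the initial value of the fold, a maximum over all systems that
   is at least [split_dim SS], which is 2. *)
rewrite /rooted_injective_dim; elim/big_ind: _ => [|m n m2 n2|SS' injSS'].
- by rewrite -{1}dimSS leq_bigmax.
- by rewrite leq_min m2 n2.
- exact: rooted_injective_dim_ge2 injSS'.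
Qed.
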